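(* Let $\mathcal{D}$ be a triangulated category with products. An object $U\in\mathcal{D}$ is cosilting if and only if the following conditions are all true: (C1) $U\in {^{\perp_{>0}}U}$; (C2) ${^{\perp_{>0}}U}$ is closed under direct products; (C3) ${^{\perp_{\mathbb{Z}}}U}=0$.
   Context: Let $\mathcal{D}$ be a triangulated category with (arbitrary set-indexed) products, and let $[1]$ be the shift functor. All triangles are distinguished triangles. Subcategories are full and closed under isomorphisms. For $U\in\mathcal{D}$, put ${^{\perp_{>0}}U}=\{X\in\mathcal{D}\mid \mathrm{Hom}_{\mathcal{D}}(X,U[p])=0\text{ for all }p>0\}$, ${^{\perp_{\leq 0}}U}=\{X\in\mathcal{D}\mid \mathrm{Hom}_{\mathcal{D}}(X,U[p])=0\text{ for all }p\leq 0\}$, and ${^{\perp_{\mathbb{Z}}}U}=\{X\in\mathcal{D}\mid \mathrm{Hom}_{\mathcal{D}}(X,U[p])=0\text{ for all }p\in\mathbb{Z}\}$. A t-structure in $\mathcal{D}$ is a pair $(\mathcal{U},\mathcal{V})$ of subcategories such that $\mathrm{Hom}_{\mathcal{D}}(X,Y)=0$ for all $X\in\mathcal{U}$, $Y\in\mathcal{V}$; $\mathcal{U}[1]\subseteq\mathcal{U}$; $\mathcal{V}[-1]\subseteq\mathcal{V}$; and for every $X\in\mathcal{D}$ there is a triangle $X'\to X\to X''\to X'[1]$ with $X'\in\mathcal{U}$ and $X''\in\mathcal{V}$. An object $U\in\mathcal{D}$ is cosilting if $({^{\perp_{\leq 0}}U},{^{\perp_{>0}}U})$ is a t-structure. *)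

(* Defs.v *)
From mathcomp Require Import all_boot all_order all_algebra.

Set Implicit Arguments.
Unset Strict Implicit.
Unset Printing Implicit Defensive.

Import Order.TTheory GRing.Theory Num.Theory.
Local Open Scope ring_scope.

Reserved Notation "g ∘ f" (at level 40, left associativity).

(* [smallType] is the universe in which the carriers of the Hom groups live, so
   "set-indexed" products are products indexed by types of the same size as
   Hom sets. The objects of a category live in an unrelated universe. *)
Definition smallType := Type@{Algebra.Zmodule.axioms_.u0}.

Record preadditiveCat := PreadditiveCat {
  Ob :> Type;
  Mor : Ob -> Ob -> zmodType;
  idm : forall X, Mor X X;
  compm : forall X Y Z, Mor Y Z -> Mor X Y -> Mor X Z;
  compmA : forall W X Y Z (h : Mor Y Z) (g : Mor X Y) (f : Mor W X),
    compm h (compm g f) = compm (compm h g) f;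
  comp1m : forall X Y (f : Mor X Y), compm (idm Y) f = f;
  compm1 : forall X Y (f : Mor X Y), compm f (idm X) = f;
  compmDl : forall X Y Z (g g' : Mor Y Z) (f : Mor X Y),
    compm (g + g') f = compm g f + compm g' f;
  compmDr : forall X Y Z (g : Mor Y Z) (f f' : Mor X Y),
    compm g (f + f') = compm g f + compm g f'
}.

Arguments Mor {p} X Y.
Arguments idm {p} X.
Arguments compm {p X Y Z} g f.

Notation "g ∘ f" := (compm g f) : ring_scope.

Section Preadditive.
Variable C : preadditiveCat.

Definition is_iso (X Y : C) (f : Mor X Y) : Prop :=
  exists2 g : Mor Y X, g ∘ f = idm X & f ∘ g = idm Y.

Definition is_zero (O : C) : Prop :=
  forall X : C, (forall f : Mor O X, f = 0) /\ (forall f : Mor X O, f = 0).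

Definition is_product (I : smallType) (F : I -> C) (P : C)
    (pi : forall i, Mor P (F i)) : Prop :=
  forall (X : C) (f : forall i, Mor X (F i)),
    exists! h : Mor X P, forall i, pi i ∘ h = f i.

Definition is_additive : Prop :=
  (exists O : C, is_zero O) /\
  (forall F : bool -> C, exists (P : C) (pi : forall b, Mor P (F b)),
     is_product pi).

Definition has_products : Prop :=
  forall (I : smallType) (F : I -> C),
    exists (P : C) (pi : forall i, Mor P (F i)), is_product pi.

Definition iso_closed (A : C -> Prop) : Prop :=
  forall (X Y : C) (f : Mor X Y), is_iso f -> A X -> A Y.

Definition closed_under_products (A : C -> Prop) : Prop :=
  forall (I : smallType) (F : I -> C) (P : C) (pi : forall i, Mor P (F i)),
    is_product pi -> (forall i, A (F i)) -> A P.

End Preadditive.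

Record additiveFunctor (C D : preadditiveCat) := AdditiveFunctor {
  fob :> C -> D;
  fmap : forall X Y : C, Mor X Y -> Mor (fob X) (fob Y);
  fmap1 : forall X : C, fmap (idm X) = idm (fob X);
  fmapM : forall (X Y Z : C) (g : Mor Y Z) (f : Mor X Y),
    fmap (g ∘ f) = fmap g ∘ fmap f;
  fmapD : forall (X Y : C) (f g : Mor X Y), fmap (f + g) = fmap f + fmap g
}.

Arguments fmap {C D} a {X Y} f.

(* [Shift] is an autoequivalence with a chosen quasi-inverse [Unshift]; it is
   not required to be a strict automorphism. *)
Record triangulatedCat := TriangulatedCat {
  tri_base :> preadditiveCat;
  additivity : is_additive tri_base;

  Shift : additiveFunctor tri_base tri_base;
  Unshift : additiveFunctor tri_base tri_base;
  shift_unit : forall X : tri_base, Mor X (Unshift (Shift X));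
  shift_unit_iso : forall X : tri_base, is_iso (shift_unit X);
  shift_unit_nat : forall (X Y : tri_base) (f : Mor X Y),
    shift_unit Y ∘ f = fmap Unshift (fmap Shift f) ∘ shift_unit X;
  shift_counit : forall X : tri_base, Mor (Shift (Unshift X)) X;
  shift_counit_iso : forall X : tri_base, is_iso (shift_counit X);
  shift_counit_nat : forall (X Y : tri_base) (f : Mor X Y),
    f ∘ shift_counit X = shift_counit Y ∘ fmap Shift (fmap Unshift f);

  (* [tri f g h]: X --f--> Y --g--> Z --h--> X[1] is a distinguished triangle *)
  tri : forall X Y Z : tri_base, Mor X Y -> Mor Y Z -> Mor Z (Shift X) -> Prop;

  tri_iso : forall (X Y Z X' Y' Z' : tri_base)
      (f : Mor X Y) (g : Mor Y Z) (h : Mor Z (Shift X))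
      (f' : Mor X' Y') (g' : Mor Y' Z') (h' : Mor Z' (Shift X'))
      (a : Mor X X') (b : Mor Y Y') (c : Mor Z Z'),
    is_iso a -> is_iso b -> is_iso c ->
    b ∘ f = f' ∘ a -> c ∘ g = g' ∘ b -> fmap Shift a ∘ h = h' ∘ c ->
    tri f g h -> tri f' g' h';

  tri_id : forall X O : tri_base, is_zero O ->
    tri (idm X) (0 : Mor X O) (0 : Mor O (Shift X));

  tri_complete : forall (X Y : tri_base) (f : Mor X Y),
    exists (Z : tri_base) (g : Mor Y Z) (h : Mor Z (Shift X)), tri f g h;

  tri_rotate : forall (X Y Z : tri_base)
      (f : Mor X Y) (g : Mor Y Z) (h : Mor Z (Shift X)),
    tri f g h <-> tri g h (- fmap Shift f);

  tri_morphism : forall (X Y Z X' Y' Z' : tri_base)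
      (f : Mor X Y) (g : Mor Y Z) (h : Mor Z (Shift X))
      (f' : Mor X' Y') (g' : Mor Y' Z') (h' : Mor Z' (Shift X'))
      (a : Mor X X') (b : Mor Y Y'),
    tri f g h -> tri f' g' h' -> b ∘ f = f' ∘ a ->
    exists2 c : Mor Z Z', c ∘ g = g' ∘ b & fmap Shift a ∘ h = h' ∘ c;

  tri_octahedral : forall (X Y Z X' Y' Z' : tri_base)
      (f : Mor X Y) (f1 : Mor Y Z') (f2 : Mor Z' (Shift X))
      (g : Mor Y Z) (g1 : Mor Z X') (g2 : Mor X' (Shift Y))
      (h1 : Mor Z Y') (h2 : Mor Y' (Shift X)),
    tri f f1 f2 -> tri g g1 g2 -> tri (g ∘ f) h1 h2 ->
    exists (u : Mor Z' Y') (v : Mor Y' X'),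
      [/\ tri u v (fmap Shift f1 ∘ g2),
          u ∘ f1 = h1 ∘ g, h2 ∘ u = f2,
          v ∘ h1 = g1 & g2 ∘ v = fmap Shift f ∘ h2]
}.

Arguments Shift {t}.
Arguments Unshift {t}.
Arguments tri {t X Y Z} f g h.

Section Cosilting.
Variable D : triangulatedCat.

Definition shiftz (X : D) (p : int) : D :=
  match p with
  | Posz n => iter n Shift X
  | Negz n => iter n.+1 Unshift X
  end.

Definition perp_gt0 (U X : D) : Prop :=
  forall p : int, 0 < p -> forall f : Mor X (shiftz U p), f = 0.

Definition perp_le0 (U X : D) : Prop :=
  forall p : int, p <= 0 -> forall f : Mor X (shiftz U p), f = 0.

Definition perp_Z (U X : D) : Prop :=
  forall (p : int) (f : Mor X (shiftz U p)), f = 0.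

Record t_structure (A B : D -> Prop) : Prop := TStructure {
  tst_isoA : iso_closed A;
  tst_isoB : iso_closed B;
  tst_hom0 : forall X Y : D, A X -> B Y -> forall f : Mor X Y, f = 0;
  tst_shiftA : forall X : D, A X -> A (Shift X);
  tst_shiftB : forall X : D, B X -> B (Unshift X);
  tst_triangle : forall X : D,
    exists (X' X'' : D) (f : Mor X' X) (g : Mor X X'') (h : Mor X'' (Shift X')),
      [/\ A X', B X'' & tri f g h]
}.

Definition cosilting (U : D) : Prop :=
  t_structure (perp_le0 U) (perp_gt0 U).

End Cosilting.

(* Main.v *)
Require Import Defs.
From mathcomp Require Import all_boot all_order all_algebra.
From mathcomp Require Import zify.
From Stdlib Require Import IndefiniteDescription.

(** Write A = [perp_le0 U], B = [perp_gt0 U] and U[p] = [shiftz U p].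

    If (A, B) is a t-structure, then B contains every Y with Hom(A, Y) = 0: the
    first map of the truncation triangle A' -> Y -> B' vanishes, so Y is a
    retract of B'. This gives (C1), since Hom(A, U) = 0 by the definition of A,
    and (C2), since having no nonzero map from A passes to products. An object
    of the intersection of A and B has zero identity, which is (C3).

    For the converse, let X be any object. Put X_0 = X, let P_n be the power of
    U[-n] indexed by Hom(X_n, U[-n]), and let X_(n+1) be the fiber of the
    canonical map X_n -> P_n. By construction maps X_n -> U[-n] die on X_(n+1),
    and (C1), (C2) ensure that no new maps to U[q], -n <= q <= 0, appear; so
    Hom(X_n, U[q]) = 0 for -n < q <= 0. Let F_n be the cone of X_n -> X. By the
    octahedral axiom F_(n+1) -> F_n has fiber P_n, hence every F_n lies in B,
    receives no nonzero map from A, and F_oo = holim F_n inherits both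
    properties. The maps X -> F_n induce X -> F_oo, whose fiber X' is the
    candidate for the truncation of X in A ([truncation]).

    That X' lies in A amounts to comparing maps from F_oo and from X to U[r],
    r <= 0. The cone P_n[1] of F_(n+1) -> F_n maps trivially to U[k] for
    k > 1 - n, so in a fixed range of degrees the tower is eventually constant,
    and every map F_oo -> U[r] factors through some F_n
    ([holim_factors_through_stage]). This uses no finiteness of U: the cones form
    a class closed under products by (C2), and a product of triangles is a
    triangle ([product_tri]). At the level of F_n the comparison is immediate,
    because X_n has no maps to U[q] in the relevant degrees.

    Condition (C3) enters once, for Hom(A, B) = 0. If Y is in B, the triangle
    Y' -> Y -> F_oo has Y' both in A and in B, hence Y' = 0, and F_oo receives
    no nonzero map from A. *)

Set Implicit Arguments.
Unset Strict Implicit.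
Unset Printing Implicit Defensive.

Import Order.TTheory GRing.Theory Num.Theory.
Local Open Scope ring_scope.

(** * Preadditive categories *)

Lemma choice_family (I : Type) (T : I -> Type) (R : forall i, T i -> Prop) :
  (forall i, exists x, R i x) -> exists f : forall i, T i, forall i, R i (f i).
Proof.
move=> ex; pose c i := constructive_indefinite_description _ (ex i).
by exists (fun i => proj1_sig (c i)) => i; exact: proj2_sig (c i).
Qed.

Section Preadditive.
Variable C : preadditiveCat.
Implicit Types W X Y Z : C.

Lemma comp0m X Y Z (f : Mor X Y) : (0 : Mor Y Z) ∘ f = 0.
Proof. by apply: (addrI (0 ∘ f)); rewrite -compmDl !addr0. Qed.

Lemma compm0 X Y Z (g : Mor Y Z) : g ∘ (0 : Mor X Y) = 0.
Proof. by apply: (addrI (g ∘ 0)); rewrite -compmDr !addr0. Qed.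

Lemma compNm X Y Z (g : Mor Y Z) (f : Mor X Y) : (- g) ∘ f = - (g ∘ f).
Proof. by apply: (addrI (g ∘ f)); rewrite -compmDl !subrr comp0m. Qed.

Lemma compmN X Y Z (g : Mor Y Z) (f : Mor X Y) : g ∘ (- f) = - (g ∘ f).
Proof. by apply: (addrI (g ∘ f)); rewrite -compmDr !subrr compm0. Qed.

Lemma compmBl X Y Z (g g' : Mor Y Z) (f : Mor X Y) :
  (g - g') ∘ f = g ∘ f - g' ∘ f.
Proof. by rewrite compmDl compNm. Qed.

Lemma compmBr X Y Z (g : Mor Y Z) (f f' : Mor X Y) :
  g ∘ (f - f') = g ∘ f - g ∘ f'.
Proof. by rewrite compmDr compmN. Qed.

Lemma is_iso_id X : is_iso (idm X).
Proof. by exists (idm X); rewrite comp1m. Qed.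

Definition hom_zero X Y : Prop := forall f : Mor X Y, f = 0.

Lemma hom_zero_retractl X X' W (s : Mor X X') (r : Mor X' X) :
  r ∘ s = idm X -> hom_zero X' W -> hom_zero X W.
Proof. by move=> rs z f; rewrite -(compm1 f) -rs compmA (z (f ∘ r)) comp0m. Qed.

Lemma hom_zero_retractr X Y Y' (s : Mor Y Y') (r : Mor Y' Y) :
  r ∘ s = idm Y -> hom_zero X Y' -> hom_zero X Y.
Proof. by move=> rs z f; rewrite -(comp1m f) -rs -compmA (z (s ∘ f)) compm0. Qed.

Lemma is_zero_idm X : idm X = 0 -> is_zero X.
Proof.
move=> id0 Y; split=> f; first by rewrite -(compm1 f) id0 compm0.
by rewrite -(comp1m f) id0 comp0m.
Qed.

Lemma product_ext (I : smallType) (F : I -> C) P (pi : forall i, Mor P (F i)) X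
    (h h' : Mor X P) :
  is_product pi -> (forall i, pi i ∘ h = pi i ∘ h') -> h = h'.
Proof.
move=> prodP eq_hh'.
have [k [_ uniq_k]] := prodP X (fun i => pi i ∘ h).
by rewrite -(uniq_k h) // -(uniq_k h').
Qed.

Lemma hom_zero_product (I : smallType) (F : I -> C) P (pi : forall i, Mor P (F i)) X :
  is_product pi -> (forall i, hom_zero X (F i)) -> hom_zero X P.
Proof.
move=> prodP z f; apply: (product_ext prodP) => i.
by rewrite compm0 (z i (pi i ∘ f)).
Qed.

End Preadditive.

Section AdditiveFunctor.
Variables (C D : preadditiveCat) (T : additiveFunctor C D).

Lemma fmap0 (X Y : C) : fmap T (0 : Mor X Y) = 0.
Proof. by apply: (addrI (fmap T 0)); rewrite -fmapD !addr0. Qed.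

Lemma fmapN (X Y : C) (f : Mor X Y) : fmap T (- f) = - fmap T f.
Proof. by apply: (addrI (fmap T f)); rewrite -fmapD !subrr fmap0. Qed.

Lemma fmap_zero (O : C) : is_zero O -> is_zero (T O).
Proof.
by move=> zO; apply: is_zero_idm; rewrite -fmap1 ((zO O).1 (idm O)) fmap0.
Qed.

Lemma fmap_iso (X Y : C) (f : Mor X Y) : is_iso f -> is_iso (fmap T f).
Proof. by case=> g gf fg; exists (fmap T g); rewrite -fmapM ?gf ?fg fmap1. Qed.

End AdditiveFunctor.

(** * The shift functor *)

Section Triangulated.
Variable D : triangulatedCat.
Implicit Types W X Y Z : D.

Lemma unshift_inj X Y : injective (@fmap D D Unshift X Y).
Proof.
move=> f g eq_fg; have [c cl cr] := shift_counit_iso (t := D) X.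
by rewrite -(compm1 f) -(compm1 g) -cr !compmA !shift_counit_nat eq_fg.
Qed.

Lemma shift_inj X Y : injective (@fmap D D Shift X Y).
Proof.
move=> f g eq_fg; have [u ul ur] := shift_unit_iso (t := D) Y.
by rewrite -(comp1m f) -(comp1m g) -ul -!compmA !shift_unit_nat eq_fg.
Qed.

Lemma shift_full X Y (e : Mor (Shift X) (Shift Y)) : exists f : Mor X Y, fmap Shift f = e.
Proof.
have [u ul ur] := shift_unit_iso (t := D) Y.
have [v vl vr] := shift_unit_iso (t := D) X.
exists (u ∘ (fmap Unshift e ∘ shift_unit X)); apply: unshift_inj.
rewrite -[LHS]compm1 -vr compmA -shift_unit_nat !compmA ur comp1m.
by rewrite -compmA vr compm1.
Qed.

Lemma hom_zero_shift X Y : hom_zero (Shift X) (Shift Y) <-> hom_zero X Y.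
Proof.
split=> z f; first by apply: shift_inj; rewrite fmap0; exact: z.
by have [g <-] := shift_full f; rewrite (z g) fmap0.
Qed.

Lemma shift_product (I : smallType) (F : I -> D) P (pi : forall i, Mor P (F i)) :
  is_product pi -> is_product (fun i => fmap Shift (pi i)).
Proof.
move=> prodP W f; have [c cl cr] := shift_counit_iso (t := D) W.
have [g gE] := choice_family (fun i => shift_full (f i ∘ shift_counit W)).
have [h [hE _]] := prodP _ g.
exists (fmap Shift h ∘ c); split=> [i|k kE].
  by rewrite compmA -fmapM hE gE -compmA cr compm1.
have [k' k'E] := shift_full (k ∘ shift_counit W).
suff ->: h = k' by rewrite k'E -compmA cr compm1.
apply: (product_ext prodP) => i; apply: shift_inj.
by rewrite hE gE fmapM k'E compmA kE.
Qed.

(** * Triangles *)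

Lemma zero_exists : exists O : D, is_zero O.
Proof. by case: (additivity D). Qed.

Lemma tri_comp X Y Z (f : Mor X Y) (g : Mor Y Z) (h : Mor Z (Shift X)) :
  tri f g h -> g ∘ f = 0.
Proof.
move=> t; have [O zO] := zero_exists.
have [|c cE _] := tri_morphism (tri_id X zO) t (a := idm X) (b := f).
  by [].
by rewrite -cE compm0.
Qed.

Lemma tri_rot X Y Z (f : Mor X Y) (g : Mor Y Z) (h : Mor Z (Shift X)) :
  tri f g h -> tri g h (- fmap Shift f).
Proof. by move/tri_rotate. Qed.

Lemma tri_comp2 X Y Z (f : Mor X Y) (g : Mor Y Z) (h : Mor Z (Shift X)) :
  tri f g h -> h ∘ g = 0.
Proof. by move=> /tri_rotate/tri_comp. Qed.

(** Any e killing f extends to a morphism from the given triangle to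
    0 -> W = W -> 0, a rotation of the trivial triangle on W. *)
Lemma tri_weak_cokernel X Y Z (f : Mor X Y) (g : Mor Y Z) (h : Mor Z (Shift X))
    W (e : Mor Y W) :
  tri f g h -> e ∘ f = 0 -> exists e' : Mor Z W, e = e' ∘ g.
Proof.
move=> t ef0; have [O zO] := zero_exists.
have tW : tri (0 : Mor O W) (idm W) (0 : Mor W (Shift O)).
  apply/tri_rotate; rewrite fmap0 oppr0.
  exact: tri_id (fmap_zero Shift zO).
have [|c cE _] := tri_morphism t tW (a := 0) (b := e).
  by rewrite ef0 comp0m.
by exists c; rewrite cE comp1m.
Qed.

(** Dual to the previous lemma, with the triangle W -> 0 -> W[1] -> W[1]; the
    third component is a map between shifts, so fullness and faithfulness of the
    shift bring it back. *)
Lemma tri_weak_kernel X Y Z (f : Mor X Y) (g : Mor Y Z) (h : Mor Z (Shift X))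
    W (e : Mor W Y) :
  tri f g h -> g ∘ e = 0 -> exists e' : Mor W X, e = f ∘ e'.
Proof.
move=> /tri_rotate t ge0; have [O zO] := zero_exists.
have /tri_rotate tW := tri_id W zO.
have [|c _ cE] := tri_morphism tW t (a := e) (b := 0).
  by rewrite ge0 comp0m.
have [e' e'E] := shift_full c; exists e'; apply: shift_inj.
apply: oppr_inj; rewrite fmapM e'E -compNm -cE fmap1.
by rewrite compmN compm1.
Qed.

(** Complete g to a triangle with third object C and take X = C[-1]; the shift
    being only an equivalence, C has to be replaced by C[-1][1]. *)
Lemma tri_fiber Y Z (g : Mor Y Z) :
  exists X (f : Mor X Y) (h : Mor Z (Shift X)), tri f g h.
Proof.
have [C [u [v t]]] := tri_complete g.
have [c cl cr] := shift_counit_iso (t := D) C.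
have [f fE] := shift_full (- (v ∘ shift_counit C)).
exists (Unshift C), f, (c ∘ u); apply/tri_rotate.
rewrite fE opprK; apply: (tri_iso _ _ _ _ _ _ t).
- exact: is_iso_id.
- exact: is_iso_id.
- by exists (shift_counit C); [exact: cr | exact: cl].
- by rewrite comp1m compm1.
- by rewrite compm1.
- by rewrite fmap1 comp1m -compmA cr compm1.
Qed.

Lemma hom_zero_tri_mid X Y Z (f : Mor X Y) (g : Mor Y Z) (h : Mor Z (Shift X)) W :
  tri f g h -> hom_zero X W -> hom_zero Z W -> hom_zero Y W.
Proof.
move=> t zX zZ e; have [e' ->] := tri_weak_cokernel t (zX (e ∘ f)).
by rewrite (zZ e') comp0m.
Qed.

Lemma hom_zero_tri_fiber X Y Z (f : Mor X Y) (g : Mor Y Z) (h : Mor Z (Shift X)) W :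
  tri f g h -> hom_zero Y W -> hom_zero Z (Shift W) -> hom_zero X W.
Proof.
move=> /tri_rotate/tri_rotate t zY zZ; apply/hom_zero_shift.
by apply: (hom_zero_tri_mid t) => //; apply/hom_zero_shift.
Qed.

Lemma hom_zero_to_tri_mid X Y Z (f : Mor X Y) (g : Mor Y Z) (h : Mor Z (Shift X)) W :
  tri f g h -> hom_zero W X -> hom_zero W Z -> hom_zero W Y.
Proof.
move=> t zX zZ e; have [e' ->] := tri_weak_kernel t (zZ (g ∘ e)).
by rewrite (zX e') compm0.
Qed.

(** The obstruction to extending e along f is e[1] composed with h, a map
    Z -> W[1]. *)
Lemma tri_extend X Y Z (f : Mor X Y) (g : Mor Y Z) (h : Mor Z (Shift X)) W
    (e : Mor X W) :
  tri f g h -> hom_zero Z (Shift W) -> exists e' : Mor Y W, e = e' ∘ f.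
Proof.
move=> /tri_rotate/tri_rotate t z.
have [k kE] := tri_weak_cokernel t (z (fmap Shift e ∘ h)).
have [k' k'E] := shift_full k; exists (- k'); apply: shift_inj.
by rewrite kE -k'E compmN -fmapM compNm fmapN.
Qed.

Lemma tri_cancel X Y Z (f : Mor X Y) (g : Mor Y Z) (h : Mor Z (Shift X)) W
    (e : Mor Y W) :
  tri f g h -> hom_zero Z W -> e ∘ f = 0 -> e = 0.
Proof.
move=> t z /(tri_weak_cokernel t)[e' ->].
by rewrite (z e') comp0m.
Qed.

Lemma tri_split X Y Z (f : Mor X Y) (g : Mor Y Z) (h : Mor Z (Shift X)) :
  tri f g h -> f = 0 -> exists r : Mor Z Y, r ∘ g = idm Y.
Proof.
move=> t f0; have [|r rE] := tri_weak_cokernel (e := idm Y) t.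
  by rewrite f0 compm0.
by exists r.
Qed.

(** A product of triangles is a triangle. Let C be a cone of the product f of
    the a_i. The maps C -> Z_i given by the morphism axiom assemble to
    k : C -> PZ, and k is an isomorphism by the five lemma applied to Hom(W, -):
    rows of the form Hom(W, product) are products of exact sequences. The chases
    give injectivity ([k_inj]) for all W and surjectivity for W = PZ, which
    suffices. *)
Lemma product_tri (I : smallType) (X Y Z : I -> D)
    (a : forall i, Mor (X i) (Y i)) (b : forall i, Mor (Y i) (Z i))
    (c : forall i, Mor (Z i) (Shift (X i)))
    PX (piX : forall i, Mor PX (X i)) PY (piY : forall i, Mor PY (Y i))
    PZ (piZ : forall i, Mor PZ (Z i)) (f : Mor PX PY) :
  (forall i, tri (a i) (b i) (c i)) ->
  is_product piX -> is_product piY -> is_product piZ ->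
  (forall i, piY i ∘ f = a i ∘ piX i) ->
  exists (g : Mor PY PZ) (h : Mor PZ (Shift PX)), tri f g h.
Proof.
move=> t prodX prodY prodZ fE.
have [C [u [v tf]]] := tri_complete f.
have [w wE] := choice_family (R := fun i (w : Mor C (Z i)) =>
    w ∘ u = b i ∘ piY i /\ fmap Shift (piX i) ∘ v = c i ∘ w)
  (fun i => let: ex_intro2 w p q := tri_morphism tf (t i) (fE i) in
            ex_intro _ w (conj p q)).
have [k [kE _]] := prodZ _ w.
have sprodX := shift_product prodX; have sprodY := shift_product prodY.
have k_inj W (z : Mor W C) : k ∘ z = 0 -> z = 0.
  move=> kz0; have wz0 i : w i ∘ z = 0 by rewrite -kE -compmA kz0 compm0.
  have vz0 : v ∘ z = 0.
    apply: (product_ext sprodX) => i.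
    by rewrite compmA (wE i).2 -compmA wz0 !compm0.
  have [y yE] := tri_weak_kernel (tri_rot tf) vz0.
  have ex_x i : exists x : Mor W (X i), piY i ∘ y = a i ∘ x.
    by apply: tri_weak_kernel (t i) _; rewrite compmA -(wE i).1 -compmA -yE.
  have [x xE] := choice_family ex_x; have [x' [x'E _]] := prodX _ x.
  have yE' : y = f ∘ x'.
    by apply: (product_ext prodY) => i; rewrite xE compmA fE -compmA x'E.
  by rewrite yE yE' compmA (tri_comp tf) comp0m.
have [s sE] : exists s : Mor PZ C, k ∘ s = idm PZ.
  have [x [xE _]] := sprodX _ (fun i => c i ∘ piZ i).
  have [s0 s0E] : exists s0, x = v ∘ s0.
    apply: tri_weak_kernel (tri_rot (tri_rot tf)) _.
    apply: (product_ext sprodY) => i.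
    rewrite compm0 compNm compmN compmA -fmapM fE fmapM -compmA xE compmA.
    by rewrite -!compNm (tri_comp2 (tri_rot (t i))) comp0m.
  have ex_y i : exists y : Mor PZ (Y i), w i ∘ s0 - piZ i = b i ∘ y.
    apply: tri_weak_kernel (tri_rot (t i)) _.
    by rewrite compmBr compmA -(wE i).2 -compmA -s0E xE subrr.
  have [y yE] := choice_family ex_y; have [y' [y'E _]] := prodY _ y.
  exists (s0 - u ∘ y'); apply: (product_ext prodZ) => i.
  rewrite compm1 compmA kE compmBr [w i ∘ (u ∘ y')]compmA (wE i).1.
  by rewrite -compmA y'E -yE opprB addrC subrK.
have sk : s ∘ k = idm C.
  apply/eqP; rewrite -subr_eq0; apply/eqP/k_inj.
  by rewrite compmBr compmA sE comp1m compm1 subrr.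
exists (k ∘ u), (v ∘ s); apply: (tri_iso _ _ _ _ _ _ tf).
- exact: is_iso_id.
- exact: is_iso_id.
- by exists s; [exact: sk | exact: sE].
- by rewrite comp1m compm1.
- by rewrite compm1.
- by rewrite fmap1 comp1m -compmA sk compm1.
Qed.

End Triangulated.
(** * Homotopy limits of towers *)

Section Towers.
Variable D : triangulatedCat.
Implicit Types W X Y Z L : D.

(** The endomorphism of the product of the F_n whose fiber is the homotopy
    limit of the tower. *)
Definition one_minus_shift (F : nat -> D) (f : forall n, Mor (F n.+1) (F n))
    P (pi : forall n, Mor P (F n)) (s : Mor P P) : Prop :=
  forall n, pi n ∘ s = pi n - f n ∘ pi n.+1.

Fixpoint to_bottom (F : nat -> D) (f : forall n, Mor (F n.+1) (F n)) n :
    Mor (F n) (F 0%N) :=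
  match n return Mor (F n) (F 0%N) with
  | 0%N => idm (F 0%N)
  | n'.+1 => to_bottom f n' ∘ f n'
  end.

Definition nat_case (T : nat -> Type) (x : T 0%N) (y : forall n, T n.+1) n : T n :=
  match n with 0%N => x | n'.+1 => y n' end.

Definition extension_closed (N : D -> Prop) : Prop :=
  forall X Y Z (f : Mor X Y) (g : Mor Y Z) (h : Mor Z (Shift X)),
    tri f g h -> N X -> N Z -> N Y.

Definition cone_in (N : D -> Prop) X Y (f : Mor X Y) : Prop :=
  exists Z (g : Mor Y Z) (h : Mor Z (Shift X)), tri f g h /\ N Z.

Lemma cone_in_id (N : D -> Prop) X :
  (forall O : D, is_zero O -> N O) -> cone_in N (idm X).
Proof.
move=> N0; have [O zO] := zero_exists D.
by exists O, 0, 0; split; [exact: tri_id | exact: N0].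
Qed.

Lemma cone_in_comp (N : D -> Prop) X Y Z (f : Mor X Y) (g : Mor Y Z) :
  extension_closed N -> cone_in N f -> cone_in N g -> cone_in N (g ∘ f).
Proof.
move=> extN [A [f1 [f2 [tf NA]]]] [B [g1 [g2 [tg NB]]]].
have [E [h1 [h2 th]]] := tri_complete (g ∘ f).
have [u [v [t _ _ _ _]]] := tri_octahedral tf tg th.
by exists E, h1, h2; split=> //; apply: extN t _ _.
Qed.

Lemma cone_in_to_bottom (N : D -> Prop) (F : nat -> D)
    (f : forall n, Mor (F n.+1) (F n)) :
  extension_closed N -> (forall O : D, is_zero O -> N O) ->
  (forall n, cone_in N (f n)) -> forall n, cone_in N (to_bottom f n).
Proof.
move=> extN N0 Nf; elim=> [|n IH] /=; first exact: cone_in_id.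
exact: cone_in_comp.
Qed.

Hypothesis hD : has_products D.

Lemma cone_in_product (N : D -> Prop) (I : smallType) (X Y : I -> D)
    (a : forall i, Mor (X i) (Y i)) PX (piX : forall i, Mor PX (X i))
    PY (piY : forall i, Mor PY (Y i)) (f : Mor PX PY) :
  closed_under_products N -> is_product piX -> is_product piY ->
  (forall i, piY i ∘ f = a i ∘ piX i) ->
  (forall i, cone_in N (a i)) -> cone_in N f.
Proof.
move=> prodN prodX prodY fE /choice_family[Z].
move=> /choice_family[b] /choice_family[c] bcP.
have [PZ [piZ prodZ]] := hD Z.
have [g [h t]] := product_tri (fun i => (bcP i).1) prodX prodY prodZ fE.
by exists PZ, g, h; split=> //; apply: (prodN _ _ _ _ prodZ) => i; case: (bcP i).
Qed.

(** On a constant tower the equation a_n - a_(n+1) = b_n is solved naturally by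
    a_n = - (b_0 + ... + b_(n-1)). *)
Lemma constant_tower_split A Q (rho : forall n : nat, Mor Q A) (s : Mor Q Q) :
  is_product (F := fun=> A) rho ->
  one_minus_shift (F := fun=> A) (fun=> idm A) rho s ->
  exists s', s ∘ s' = idm Q.
Proof.
move=> prodQ sE; have [s' [s'E _]] := prodQ Q (fun n => - \sum_(j < n) rho j).
exists s'; apply: (product_ext prodQ) => n.
rewrite compmA sE comp1m compmBl !s'E big_ord_recr /= compm1.
by rewrite opprK addKr.
Qed.

Lemma one_minus_shift_exists (F : nat -> D) (f : forall n, Mor (F n.+1) (F n))
    P (pi : forall n, Mor P (F n)) :
  is_product pi -> exists s, one_minus_shift f pi s.
Proof.
by move=> prodP; have [s [sE _]] := prodP P (fun n => pi n - f n ∘ pi n.+1); exists s.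
Qed.

(** N plays the role of negligible objects: a map with cone in N is treated as an
    isomorphism, which is legitimate for maps into an object W to which N and its
    negative shifts have no nonzero maps. *)
Section Comparison.
Variable N : D -> Prop.
Hypotheses (extN : extension_closed N) (prodN : closed_under_products N).
Hypothesis zeroN : forall O : D, is_zero O -> N O.

Lemma compare_with_constant (F : nat -> D) (f : forall n, Mor (F n.+1) (F n))
    P (pi : forall n, Mor P (F n)) :
  (forall n, cone_in N (f n)) -> is_product pi ->
  exists Q (rho : forall n : nat, Mor Q (F 0%N)) (c : Mor P Q),
    [/\ is_product (F := fun=> F 0%N) rho,
        forall n, rho n ∘ c = to_bottom f n ∘ pi n & cone_in N c].
Proof.
move=> Nf prodP; have [Q [rho prodQ]] := hD (fun _ : nat => F 0%N).
have [c [cE _]] := prodQ P (fun n => to_bottom f n ∘ pi n).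
exists Q, rho, c; split=> //.
exact: (cone_in_product prodN prodP prodQ cE (cone_in_to_bottom extN zeroN Nf)).
Qed.

(** For the tower of constant value F_0 the map 1 - shift is split epi, so only
    0 kills it. When all transition maps have cones in N, the comparison of F
    with this constant tower reduces to that case: maps to W extend along it
    uniquely. If the hypothesis on cones only holds from n on, the first n stages
    are removed one at a time: the product P of the F_k is the sum of F_0 and of
    the product P' of the tail, and on F_0 the map 1 - shift is the inclusion. *)
Lemma tower_coker_zero W n :
  (forall Z, N Z -> hom_zero Z W) -> (forall Z, N Z -> hom_zero Z (Shift W)) ->
  forall (F : nat -> D) (f : forall n, Mor (F n.+1) (F n))
    P (pi : forall n, Mor P (F n)) (s : Mor P P) (d : Mor P W),
  (forall k, (n <= k)%N -> cone_in N (f k)) ->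
  is_product pi -> one_minus_shift f pi s -> d ∘ s = 0 -> d = 0.
Proof.
move=> NW NSW; elim: n => [|n IH] F f P pi s d Nf prodP sE ds0.
  have [Q [rho [c [prodQ cE [Z [g [h [t NZ]]]]]]]] :=
    compare_with_constant (fun k => Nf k isT) prodP.
  have [d' d'E] := tri_extend d t (NSW _ NZ).
  have [s' s'E] := one_minus_shift_exists (F := fun=> F 0%N) (fun=> idm _) prodQ.
  have [s'' ss''] := constant_tower_split prodQ s'E.
  have cs : c ∘ s = s' ∘ c.
    apply: (product_ext prodQ) => k.
    rewrite !compmA cE s'E -compmA sE compmBl comp1m !cE /= compmBr.
    by rewrite -!compmA.
  have d's' : d' ∘ s' = 0.
    by apply: (tri_cancel t (NW _ NZ)); rewrite -compmA -cs compmA -d'E.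
  by rewrite d'E -(compm1 d') -ss'' compmA d's' !comp0m.
have [P' [pi' prodP']] := hD (fun k => F k.+1).
(* i0 and i are the inclusions of the summands F_0 and P'; p is the projection
   to P'. The map j is the other lift of the identity of P', chosen with first
   component f_0 so that it intertwines 1 - shift on P' and on P: s j = i s'. *)
have [i0 [i0E _]] := prodP (F 0%N)
  (nat_case (T := fun k => Mor (F 0%N) (F k)) (idm _) (fun=> 0)).
have [j [jE _]] := prodP P'
  (nat_case (T := fun k => Mor P' (F k)) (f 0%N ∘ pi' 0%N) pi').
have [i [iE _]] := prodP P' (nat_case (T := fun k => Mor P' (F k)) 0 pi').
have [p [pE _]] := prodP' P (fun k => pi k.+1).
have [s' s'E] := one_minus_shift_exists (fun k => f k.+1) prodP'.
have di0 : d ∘ i0 = 0.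
  suff <- : s ∘ i0 = i0 by rewrite compmA ds0 comp0m.
  apply: (product_ext prodP) => k.
  rewrite compmA sE compmBl -compmA [pi k.+1 ∘ _]i0E.
  by rewrite /= compm0 subr0.
have di : d ∘ i = 0.
  apply: (IH _ (fun k => f k.+1) _ pi' s') => //; first by move=> k; exact: (Nf k.+1).
  rewrite -compmA; suff <- : s ∘ j = i ∘ s' by rewrite compmA ds0 comp0m.
  apply: (product_ext prodP) => k.
  rewrite !compmA sE compmBl -compmA !jE iE; case: k => [|k] /=.
    by rewrite subrr comp0m.
  by rewrite s'E.
suff idE : idm P = i0 ∘ pi 0%N + i ∘ p.
  by rewrite -(compm1 d) idE compmDr !compmA di0 di !comp0m addr0.
apply: (product_ext prodP) => k; rewrite compm1 compmDr !compmA i0E iE.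
by case: k => [|k] /=; rewrite comp0m ?comp1m ?pE ?addr0 ?add0r.
Qed.

(** A compatible family of maps, given by x, becomes, after comparison with the tower
    of constant value F_0, a diagonal map out of F_0; and e extends along that
    comparison. Initial stages are removed as before, a compatible family being
    determined by its components on the tail. *)
Lemma compatible_factors_through_stage W n :
  (forall Z, N Z -> hom_zero Z (Shift W)) ->
  forall (F : nat -> D) (f : forall n, Mor (F n.+1) (F n))
    P (pi : forall n, Mor P (F n)) L (x : Mor L P) (e : Mor P W),
  (forall k, (n <= k)%N -> cone_in N (f k)) -> is_product pi ->
  (forall k, f k ∘ (pi k.+1 ∘ x) = pi k ∘ x) ->
  exists u : Mor (F n) W, e ∘ x = u ∘ (pi n ∘ x).
Proof.
move=> NSW; elim: n => [|n IH] F f P pi L x e Nf prodP xE.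
  have [Q [rho [c [prodQ cE [Z [g [h [t NZ]]]]]]]] :=
    compare_with_constant (fun k => Nf k isT) prodP.
  have [e' ->] := tri_extend e t (NSW _ NZ).
  have [dl [dlE _]] := prodQ (F 0%N) (fun=> idm _).
  exists (e' ∘ dl); rewrite -!compmA; congr (_ ∘ _).
  apply: (product_ext prodQ) => k; rewrite !compmA cE dlE comp1m.
  by elim: k => [|k <-] /=; rewrite ?comp1m // -!compmA xE.
have [P' [pi' prodP']] := hD (fun k => F k.+1).
have [j [jE _]] := prodP P'
  (nat_case (T := fun k => Mor P' (F k)) (f 0%N ∘ pi' 0%N) pi').
have [x' [x'E _]] := prodP' L (fun k => pi k.+1 ∘ x).
have xj : x = j ∘ x'.
  apply: (product_ext prodP) => k; rewrite compmA jE.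
  by case: k => [|k] /=; rewrite -?compmA x'E ?xE.
have [|//||u uE] := IH _ (fun k => f k.+1) P' pi' L x' (e ∘ j).
- by move=> k; exact: (Nf k.+1).
- by move=> k; rewrite !x'E xE.
by exists u; rewrite {1}xj compmA uE x'E.
Qed.

(** Cosmallness of W relative to the tower: L is the homotopy limit. The
    obstruction to extending t to the product P is a map P -> W[1] killed by
    1 - shift, hence zero by [tower_coker_zero]; the extension is then treated
    by [compatible_factors_through_stage]. *)
Lemma holim_factors_through_stage W n (F : nat -> D)
    (f : forall n, Mor (F n.+1) (F n)) P (pi : forall n, Mor P (F n))
    (s : Mor P P) L (x : Mor L P) (h : Mor P (Shift L)) (t : Mor L W) :
  (forall Z, N Z -> hom_zero Z (Shift W)) ->
  (forall Z, N Z -> hom_zero Z (Shift (Shift W))) ->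
  (forall k, (n <= k)%N -> cone_in N (f k)) ->
  is_product pi -> one_minus_shift f pi s -> tri x s h ->
  exists u : Mor (F n) W, t = u ∘ (pi n ∘ x).
Proof.
move=> NSW NSSW Nf prodP sE th.
have d0 : fmap Shift t ∘ h = 0.
  apply: (tower_coker_zero NSW NSSW Nf prodP sE).
  by rewrite -compmA (tri_comp2 th) compm0.
have [k kE] := tri_weak_cokernel (tri_rot (tri_rot th)) d0.
have [k' k'E] := shift_full k.
have tE : t = (- k') ∘ x.
  by apply: shift_inj; rewrite kE -k'E compmN -fmapM compNm fmapN.
rewrite tE; apply: (compatible_factors_through_stage NSW (- k') Nf prodP) => i.
have /eqP := congr1 (fun m => pi i ∘ m) (tri_comp th).
by rewrite compm0 compmA sE compmBl -compmA subr_eq0 => /eqP.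
Qed.

End Comparison.
End Towers.
(** * Orthogonals of the shifts of U *)

Section ShiftsOfAnObject.
Variables (D : triangulatedCat) (U : D).
Implicit Types X Y Z : D.

Lemma shiftz_succ k : exists f : Mor (Shift (shiftz U k)) (shiftz U (k + 1)), is_iso f.
Proof.
case: k => [n|[|n]].
- have ->: Posz n + 1 = Posz n.+1 by lia.
  by exists (idm _); exact: is_iso_id.
- exists (shift_counit U). exact: (shift_counit_iso U).
- have ->: Negz n.+1 + 1 = Negz n by lia.
  exists (shift_counit (iter n.+1 Unshift U)).
  exact: (shift_counit_iso (iter n.+1 Unshift U)).
Qed.

Lemma hom_zero_isol X Y W (f : Mor X Y) : is_iso f -> hom_zero X W <-> hom_zero Y W.
Proof. by case=> g gf fg; split;
  [exact: (hom_zero_retractl fg) | exact: (hom_zero_retractl gf)]. Qed.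

Lemma hom_zero_isor X Y W (f : Mor X Y) : is_iso f -> hom_zero W X <-> hom_zero W Y.
Proof. by case=> g gf fg; split;
  [exact: (hom_zero_retractr fg) | exact: (hom_zero_retractr gf)]. Qed.

Lemma hom_zero_succ X k :
  hom_zero X (shiftz U (k + 1)) <-> hom_zero X (Shift (shiftz U k)).
Proof. by have [f /hom_zero_isor e] := shiftz_succ k; apply: iff_sym. Qed.

Lemma hom_zero_shift_succ X k :
  hom_zero (Shift X) (shiftz U (k + 1)) <-> hom_zero X (shiftz U k).
Proof.
exact: iff_trans (hom_zero_succ _ _) (hom_zero_shift _ _).
Qed.

Lemma hom_zero_unshift X k :
  hom_zero (Unshift X) (shiftz U k) <-> hom_zero X (shiftz U (k + 1)).
Proof.
apply: iff_trans (iff_sym (hom_zero_shift_succ _ _)) _.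
exact: hom_zero_isol (shift_counit_iso X).
Qed.

(** For m = 0 this is [perp_gt0 U]; in general it is the m-fold shift of that
    class, see [perp_gt_shift]. *)
Definition perp_gt (m : int) X : Prop :=
  forall k, m < k -> hom_zero X (shiftz U k).

Lemma perp_gt_weaken m m' X : m <= m' -> perp_gt m X -> perp_gt m' X.
Proof. by move=> le_mm' VX k lt_k; apply: VX; exact: le_lt_trans lt_k. Qed.

Lemma perp_gt_shift m X : perp_gt (m + 1) (Shift X) <-> perp_gt m X.
Proof.
split=> VX k lt_mk; first by apply/hom_zero_shift_succ; apply: VX; lia.
by rewrite -(subrK 1 k); apply/hom_zero_shift_succ; apply: VX; lia.
Qed.

Lemma perp_gt_extension m : extension_closed (perp_gt m).
Proof.
move=> X Y Z f g h t VX VZ k lt_mk.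
by apply: (hom_zero_tri_mid t); [exact: VX | exact: VZ].
Qed.

Lemma perp_gt_zero m X : is_zero X -> perp_gt m X.
Proof. by move=> zX k _ f; exact: (zX _).1. Qed.

Lemma perp_gt_fiber m X Y Z (f : Mor X Y) (g : Mor Y Z) (h : Mor Z (Shift X)) :
  tri f g h -> perp_gt m Y -> perp_gt m Z -> perp_gt m X.
Proof.
move=> t VY VZ k lt_mk; apply: (hom_zero_tri_fiber t); first exact: VY.
by apply/hom_zero_succ; apply: VZ; lia.
Qed.

(** The shift preserves products and takes the class for -n-1 to the class
    for -n. *)
Lemma perp_gt_product (n : nat) :
  closed_under_products (perp_gt0 U) -> closed_under_products (perp_gt (- n%:Z)).
Proof.
move=> C2; elim: n => [|n IH] I F P pi prodP VF; first exact: C2 prodP VF.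
apply/perp_gt_shift; have ->: - n.+1%:Z + 1 = - n%:Z by lia.
apply: (IH _ _ _ _ (shift_product prodP)) => i.
have ->: - n%:Z = - n.+1%:Z + 1 by lia.
by apply/perp_gt_shift; exact: VF.
Qed.

Lemma perp_gt_self (n : nat) : perp_gt0 U U -> perp_gt (- n%:Z) (shiftz U (- n%:Z)).
Proof.
move=> C1; elim: n => [|n IH]; first exact: C1.
apply/perp_gt_shift; have e: - n.+1%:Z + 1 = - n%:Z by lia.
have [f /hom_zero_isol isof] := shiftz_succ (- n.+1%:Z).
by rewrite e in isof * => k lt_nk; apply/isof; exact: IH.
Qed.

Definition right_orth X : Prop := forall A, perp_le0 U A -> hom_zero A X.

Lemma perp_le0_shift X : perp_le0 U X -> perp_le0 U (Shift X).
Proof.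
move=> UX k le_k0; rewrite -(subrK 1 k); apply/hom_zero_shift_succ.
by apply: UX; lia.
Qed.

Lemma right_orth_extension : extension_closed right_orth.
Proof.
move=> X Y Z f g h t RX RZ A UA.
by apply: (hom_zero_to_tri_mid t); [exact: RX | exact: RZ].
Qed.

Lemma right_orth_fiber X Y Z (f : Mor X Y) (g : Mor Y Z) (h : Mor Z (Shift X)) :
  tri f g h -> right_orth Y -> right_orth Z -> right_orth X.
Proof.
move=> /tri_rot/tri_rot t RY RZ A UA; apply/hom_zero_shift.
apply: (hom_zero_to_tri_mid t); first exact: RZ (perp_le0_shift UA).
by apply/hom_zero_shift; exact: RY.
Qed.

Lemma right_orth_product : closed_under_products right_orth.
Proof.
move=> I F P pi prodP RF A UA.
by apply: (hom_zero_product prodP) => i; exact: RF.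
Qed.

Lemma right_orth_self (n : nat) : right_orth (shiftz U (- n%:Z)).
Proof. by move=> A UA; apply: UA; lia. Qed.

End ShiftsOfAnObject.

(** * The truncation triangle *)

Section Truncation.
Variable D : triangulatedCat.
Hypothesis hD : has_products D.

Record stage (X : D) := Stage {
  stage_ob : D;
  stage_map : Mor stage_ob X;
  stage_cone : D;
  stage_in : Mor X stage_cone;
  stage_out : Mor stage_cone (Shift stage_ob);
  stage_tri : tri stage_map stage_in stage_out
}.

(** The same power P of V occurs in two triangles: one controls maps out of the
    objects over X, the other keeps the cones in the classes of interest. *)
Definition next_stage (X V : D) (s s' : stage X)
    (f : Mor (stage_cone s') (stage_cone s)) : Prop :=
  f ∘ stage_in s' = stage_in s /\
  exists (I : smallType) (P : D) (pi : I -> Mor P V),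
    [/\ is_product (F := fun=> V) pi,
        exists b c, @tri D P _ _ b f c
      & exists (a : Mor (stage_ob s') (stage_ob s)) (e : Mor _ P) z,
          tri a e z /\ forall w : Mor (stage_ob s) V, w ∘ a = 0].

(** The octahedron on X_(n+1) -> X_n -> X yields both the map of cones and its
    fiber P. *)
Lemma next_stage_exists (X V : D) (s : stage X) : exists s' f, @next_stage X V s s' f.
Proof.
have [P [pi prodP]] := hD (fun _ : Mor (stage_ob s) V => V).
have [e [eE _]] := prodP _ (fun w => w).
have [Y [a [z t]]] := tri_fiber e.
have [F [g [h tF]]] := tri_complete (stage_map s ∘ a).
have [u [f [t' _ _ fg _]]] := tri_octahedral t (stage_tri s) tF.
exists (Stage tF), f; split=> //=; exists _, P, pi; split=> //.
  by exists u, (fmap Shift e ∘ stage_out s).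
exists a, e, z; split=> // w.
by rewrite -(eE w) -compmA (tri_comp t) compm0.
Qed.

Lemma resolution_exists (X : D) (V : nat -> D) :
  exists (s : nat -> stage X)
         (f : forall n, Mor (stage_cone (s n.+1)) (stage_cone (s n))),
    is_zero (stage_cone (s 0%N)) /\ forall n, next_stage (V n) (f n).
Proof.
have [O zO] := zero_exists D.
have ex_next (p : nat * stage X) :
    exists q : {s' & Mor (stage_cone s') (stage_cone p.2)}, next_stage (V p.1) (projT2 q).
  by have [s' [f fP]] := next_stage_exists (V p.1) p.2; exists (existT _ s' f).
have [next nextP] := choice_family ex_next.
pose s := fix s n := match n with
  | 0%N => Stage (tri_id X zO)
  | n'.+1 => projT1 (next (n', s n'))
  end.
by exists s, (fun n => projT2 (next (n, s n))); split=> // n; exact: nextP (n, s n).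
Qed.

Variable U : D.
Hypotheses (C1 : perp_gt0 U U) (C2 : closed_under_products (perp_gt0 U)).

(** The resolution of X by powers of U, U[-1], U[-2], ... and the homotopy limit
    of its cones. The last conclusion, that X'' receives no nonzero map from
    [perp_le0 U], comes from X'' being built out of products of the U[-n]; it is
    what lets (C3) imply the vanishing of Hom between the two classes. *)
Lemma truncation (X : D) :
  exists (X' X'' : D) (y : Mor X' X) (x : Mor X X'') (z : Mor X'' (Shift X')),
    [/\ tri y x z, perp_le0 U X', perp_gt0 U X'' & right_orth U X''].
Proof.
have [s [f [zs0 sf]]] := resolution_exists X (fun n => shiftz U (- n%:Z)).
pose F n := stage_cone (s n).
have Uvan (n : nat) k : - n%:Z < k -> k <= 0 -> hom_zero (stage_ob (s n)) (shiftz U k).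
  elim: n k => [|n IH] k lt_nk le_k0; first by exfalso; lia.
  have [_ [I [P [pi [prodP _ [a [e [z [t a0]]]]]]]]] := sf n.
  have VP : perp_gt U (- n%:Z) P.
    by apply: (perp_gt_product C2 prodP) => i; exact: perp_gt_self.
  have zP : hom_zero P (Shift (shiftz U k)) by apply/hom_zero_succ/VP; lia.
  (* In degree -n, maps extend to X_n and are killed there; in degrees above -n
     both neighbours of X_(n+1) have no maps. *)
  case: (eqVneq k (- n%:Z)) => [kE|neq_k] w.
    rewrite kE in zP w *; have [w' ->] := tri_extend w t zP.
    exact: a0.
  by apply: (hom_zero_tri_fiber t) => //; apply: IH; lia.
have FP n : perp_gt U 0 (F n) /\ right_orth U (F n).
  elim: n => [|n [VF RF]].
    split; first exact: perp_gt_zero.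
    by move=> A _ w; exact: (zs0 _).2.
  have [_ [I [P [pi [prodP [b [c t]] _]]]]] := sf n.
  have VP : perp_gt U (- n%:Z) P.
    by apply: (perp_gt_product C2 prodP) => i; exact: perp_gt_self.
  split; first by apply: (perp_gt_extension t) => //; apply: perp_gt_weaken VP; lia.
  apply: (right_orth_extension t) => //.
  by apply: (right_orth_product prodP) => i; exact: right_orth_self.
have coneF n k : (n < k)%N -> cone_in (perp_gt U (- n%:Z)) (f k).
  move=> lt_nk; have [_ [I [P [pi [prodP [b [c t]] _]]]]] := sf k.
  exists (Shift P), c, (- fmap Shift b); split; first exact: tri_rot.
  have VP : perp_gt U (- k%:Z) P.
    by apply: (perp_gt_product C2 prodP) => i; exact: perp_gt_self.
  by move/perp_gt_shift: VP; apply: perp_gt_weaken; lia.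
have [P [pi prodP]] := hD F.
have [d dE] := one_minus_shift_exists f prodP.
have [L [i [h th]]] := tri_fiber d.
have VP : perp_gt U 0 P by apply: (C2 prodP) => n; exact: (FP n).1.
have VL : perp_gt U 0 L by apply: perp_gt_fiber th _ _.
have RP : right_orth U P by apply: (right_orth_product prodP) => n; exact: (FP n).2.
have RL : right_orth U L by apply: right_orth_fiber th _ _.
have [x0 [x0E _]] := prodP X (fun n => stage_in (s n)).
have [|x xE] := tri_weak_kernel (e := x0) th.
  apply: (product_ext prodP) => n.
  by rewrite compm0 compmA dE compmBl -compmA !x0E (sf n).1 subrr.
have piE n : pi n ∘ (i ∘ x) = stage_in (s n) by rewrite -xE x0E.
(* Injectivity of Hom(L, U[k]) -> Hom(X, U[k]). It is needed up to k = 1, the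
   degree that obstructs surjectivity of restriction in degree 0; for k = 1 the
   source vanishes. *)
have x_cancel k (t : Mor L (shiftz U k)) : k <= 1 -> t ∘ x = 0 -> t = 0.
  move=> le_k1 tx0; case: (eqVneq k 1) => [kE|neq_k1].
    by rewrite kE in t tx0 *; exact: VL.
  (* With this n, cones of late transition maps have no maps to U[k+1] and
     U[k+2], and X_(n+1) has none to U[k-1]. *)
  pose n := `|k|%N.+1.
  have NSW Z : perp_gt U (- n%:Z) Z -> hom_zero Z (Shift (shiftz U k)).
    by move=> VZ; apply/hom_zero_succ; apply: VZ; lia.
  have NSSW Z : perp_gt U (- n%:Z) Z -> hom_zero Z (Shift (Shift (shiftz U k))).
    have [j /(fmap_iso Shift)/hom_zero_isor isoj] := shiftz_succ U k.
    by move=> VZ; apply/isoj/hom_zero_succ; apply: VZ; lia.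
  have [u uE] := holim_factors_through_stage hD
    (perp_gt_extension (m := - n%:Z)) (perp_gt_product C2 (n := n))
    (@perp_gt_zero _ _ _) t NSW NSSW (coneF n) prodP dE th.
  rewrite uE; suff ->: u = 0 by rewrite comp0m.
  apply: (tri_cancel (tri_rot (stage_tri (s n.+1)))).
    by rewrite -(subrK 1 k); apply/hom_zero_shift_succ; apply: Uvan; lia.
  by move: tx0; rewrite -(piE n.+1) uE !compmA.
have [X' [y [z t]]] := tri_fiber x.
exists X', L, y, x, z; split=> // k le_k0 a.
have za0 : fmap Shift a ∘ z = 0.
  have [j [j' j'j jj']] := shiftz_succ U k.
  rewrite -[LHS]comp1m -j'j -compmA; set w := j ∘ _.
  suff ->: w = 0 by rewrite compm0.
  apply: x_cancel; first by lia.
  by rewrite /w -!compmA (tri_comp2 t) !compm0.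
have [c cE] := tri_weak_cokernel (tri_rot (tri_rot t)) za0.
have [c' c'E] := shift_full c.
have [n nE] : exists n : nat, - n%:Z < k by exists (`|k|%N.+1); lia.
have [c'' c''E] := tri_weak_cokernel (stage_tri (s n))
  (Uvan _ _ nE le_k0 (c' ∘ stage_map (s n))).
apply: shift_inj; rewrite fmap0 cE -c'E compmN -fmapM c''E -(piE n).
by rewrite -!compmA (tri_comp t) !compm0 fmap0 oppr0.
Qed.

End Truncation.
(** * Characterization of cosilting objects *)

(** The truncation map A -> Y is zero, so Y is a retract of B. *)
Lemma perp_gt0_of_right_orth (D : triangulatedCat) (U Y : D) :
  cosilting U -> right_orth U Y -> perp_gt0 U Y.
Proof.
move=> tU RY; have [A [B [f [g [h [UA UB t]]]]]] := tst_triangle tU Y.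
have [r rg] := tri_split t (RY A UA f).
by move=> p lt_0p; apply: (hom_zero_retractl rg); exact: UB.
Qed.

Theorem corollary2p9 (D : triangulatedCat) (hD : has_products D) (U : D) :
  cosilting U <->
  [/\ perp_gt0 U U,
      closed_under_products (perp_gt0 U)
    & forall X : D, perp_Z U X <-> is_zero X].
Proof.
split=> [tU | [C1 C2 C3]].
  split.
  - by apply: perp_gt0_of_right_orth => // A UA; exact: (UA 0).
  - move=> I F P pi prodP VF; apply: perp_gt0_of_right_orth => //.
    apply: (right_orth_product prodP) => i A UA f.
    exact: (tst_hom0 tU UA (VF i)).
  - move=> X; split=> [UX|zX p f]; last exact: (zX _).1.
    apply/is_zero_idm/(tst_hom0 tU) => p _; exact: UX.
split.
- by move=> X Y f /hom_zero_isol isof UX p le_p0; apply/isof; exact: UX.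
- by move=> X Y f /hom_zero_isol isof UX p lt_0p; apply/isof; exact: UX.
- move=> X Y UX VY f.
  have [Y' [Y'' [y [x [z [t UY' VY'' RY'']]]]]] := truncation hD C1 C2 Y.
  have zY' : is_zero Y'.
    apply/C3 => p; case: (leP p 0) => [le_p0|lt_0p]; first exact: UY'.
    exact: (perp_gt_fiber t VY VY'').
  have [f' ->] := tri_weak_kernel t (RY'' X UX (x ∘ f)).
  by rewrite ((zY' _).2 f') compm0.
- exact: perp_le0_shift.
- move=> X VX p lt_0p; apply/hom_zero_unshift/VX; lia.
- move=> X; have [X' [X'' [y [x [z [t UX' VX'' _]]]]]] := truncation hD C1 C2 X.
  by exists X', X'', y, x, z.
Qed.
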